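(* Let $X$ be a Banach space not satisfying property $\mathcal{Q}$ and let $E$ be a Banach space satisfying property $\mathcal{Q}$. Then $\mathcal{CR}(X,E)\le 1/\mathcal{Q}_E$.
   Context: For metric spaces $(M_1,d_1)$, $(M_2,d_2)$ and an arbitrary (not necessarily continuous) map $\phi: M_1\to M_2$, define for $t\in(0,\infty)$ $$\kappa_\phi(t)=\inf_{d_1(x,y)\ge t} d_2(\phi(x),\phi(y)),\qquad \omega_\phi(t)=\sup_{d_1(x,y)\le t} d_2(\phi(x),\phi(y)),$$ with values in $[0,\infty]$, and $\kappa(\phi)=\sup_{t<\infty}\kappa_\phi(t)$, $\omega(\phi)=\inf_{t>0}\omega_\phi(t)$. The separation ratio of $\phi$ is $\mathcal{R}(\phi)=\kappa(\phi)/\omega(\phi)\in[0,\infty]$, with the conventions $\frac{a}{\infty}=\frac{0}{a}=0$ for all $a\in[0,\infty]$ and $\frac{a}{0}=\frac{\infty}{a}=\frac{\infty}{0}=\infty$ for all $a\in(0,\infty)$. The coarse embeddability ratio is $\mathcal{CR}(M_1,M_2)=\sup_\phi \mathcal{R}(\phi)$, the supremum over all maps $\phi:M_1\to M_2$. Banach spaces carry their norm metric. Property $\mathcal{Q}$: For $\mathbb{M}\subseteq\mathbb{N}$ and $r\in\mathbb{N}$, $[\mathbb{M}]^r$ is the set of $r$-element subsets of $\mathbb{M}$, and $[\mathbb{M}]^\omega$ is the set of infinite subsets of $\mathbb{M}$. The Kalton interlacing graph $K_r(\mathbb{N})$ has vertex set $[\mathbb{N}]^r$; two distinct vertices $A=\{a_1<\dots<a_r\}$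 and $B=\{b_1<\dots<b_r\}$ are joined by an edge if $a_1\le b_1\le a_2\le\cdots\le a_r\le b_r$ or $b_1\le a_1\le b_2\le\cdots\le b_r\le a_r$. It is connected and carries its shortest path metric. For $\epsilon,\delta>0$, a metric space $(M,d)$ has property $\mathcal{Q}(\epsilon,\delta)$ if for all $r\in\mathbb{N}$ and all $f:K_r(\mathbb{N})\to M$ with $\omega_f(1)\le\delta$ there exists $\mathbb{M}\in[\mathbb{N}]^\omega$ such that $d(f(A),f(B))\le\epsilon$ for all $A,B\in[\mathbb{M}]^r$ with $\max(A)<\min(B)$. Set $\Delta_M(\epsilon)=\sup\{\delta\ge0: M \text{ has property } \mathcal{Q}(\epsilon,\delta)\}$ and $\mathcal{Q}_M=\sup\{c\ge0:\Delta_M(\epsilon)\ge c\epsilon\text{ for all }\epsilon>0\}$ (the value $\infty$ is allowed, with $1/\infty=0$). $M$ has (satisfies) property $\mathcal{Q}$ if $\mathcal{Q}_M>0$. *)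

(* Defs.v *)
From HB Require Import structures.
From mathcomp Require Import all_boot all_order all_algebra finmap.
From mathcomp Require Import all_classical all_reals all_analysis.

Set Implicit Arguments.
Unset Strict Implicit.
Unset Printing Implicit Defensive.

Import Order.TTheory GRing.Theory Num.Theory.
Import numFieldNormedType.Exports.

Local Open Scope classical_set_scope.
Local Open Scope ring_scope.

(* [normedModType] does not inherit from [metricType] in the library: this
   alias carries the pseudometric structure of V together with the norm
   metric. *)
Definition norm_metric (R : realType) (V : normedModType R) : Type := V.

Section NormMetric.
Context {R : realType} (V : normedModType R).

HB.instance Definition _ := PseudoMetric.copy (norm_metric V) V.

Let ndist (x y : norm_metric V) : R := `|(x : V) - (y : V)|.

Let ndist_ge0 x y : 0 <= ndist x y.
Proof. exact: normr_ge0. Qed.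

Let ndist_positivity x y : ndist x y = 0 -> x = y.
Proof. by move/normr0_eq0/eqP; rewrite subr_eq0 => /eqP. Qed.

Let ballEndist (x : norm_metric V) (e : R) :
  ball x e = [set y | ndist x y < e].
Proof.
rewrite /ndist; change (@ball R V x e = [set y : V | `|(x : V) - y| < e]).
by rewrite -ball_normE.
Qed.

HB.instance Definition _ := PseudoMetric_isMetric.Build R (norm_metric V)
  ndist_ge0 ndist_positivity ballEndist.

Lemma mdist_normE (x y : norm_metric V) : mdist x y = `|(x : V) - (y : V)|.
Proof. by []. Qed.

End NormMetric.

Section Moduli.
Local Open Scope ereal_scope.
Context {R : realType} {M1 M2 : metricType R}.
Implicit Types (phi : M1 -> M2) (t : R).

Definition kappa_at phi t : \bar R :=
  ereal_inf [set (mdist (phi p.1) (phi p.2))%:E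
            | p in [set p : M1 * M1 | (t <= mdist p.1 p.2)%R]].

Definition omega_at phi t : \bar R :=
  ereal_sup [set (mdist (phi p.1) (phi p.2))%:E
            | p in [set p : M1 * M1 | (mdist p.1 p.2 <= t)%R]].

Definition kappa phi : \bar R :=
  ereal_sup [set kappa_at phi t | t in [set t : R | (0 < t)%R]].

Definition omega phi : \bar R :=
  ereal_inf [set omega_at phi t | t in [set t : R | (0 < t)%R]].

(* On [0, +oo], the library's division satisfies a / +oo = 0 / a = 0 for every
   a (so 0 / 0 = +oo / +oo = 0), and a / 0 = +oo / b = +oo for 0 < a <= +oo
   and 0 <= b < +oo. *)
Definition separation_ratio phi : \bar R := kappa phi / omega phi.

End Moduli.

Definition coarse_ratio {R : realType} (M1 M2 : metricType R) : \bar R :=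
  ereal_sup (range (@separation_ratio R M1 M2)).

Definition ksubset (r : nat) : Type := {A : {fset nat} | #|` A| == r}.

HB.instance Definition _ (r : nat) := Choice.on (ksubset r).

Definition kset r (A : ksubset r) : {fset nat} := val A.

(* a_1 < ... < a_r are kelt A 0, ..., kelt A r.-1 *)
Definition kelt r (A : ksubset r) (i : nat) : nat := nth 0%N (sort leq (kset A)) i.

Definition interlaced r (A B : ksubset r) : bool :=
  [forall i : 'I_r, (kelt A i <= kelt B i)%N] &&
  [forall i : 'I_r, (i.+1 < r)%N ==> (kelt B i <= kelt A i.+1)%N].

Definition kadj r : rel (ksubset r) :=
  [rel A B | (A != B) && (interlaced A B || interlaced B A)].

Definition kwalk r (A B : ksubset r) (n : nat) : Prop :=
  exists p : seq (ksubset r), [/\ path (@kadj r) A p, last A p = B & size p = n].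

Section Connected.
Variable r : nat.
Implicit Types A B C : ksubset r.

Let kseq A : seq nat := sort leq (kset A).

Lemma size_kseq A : size (kseq A) = r.
Proof. by rewrite size_sort; apply/eqP; exact: (valP A). Qed.

Lemma kseq_sorted A : sorted ltn (kseq A).
Proof.
by rewrite ltn_sorted_uniq_leq sort_uniq fset_uniq /= sort_sorted //; exact: leq_total.
Qed.

Lemma mem_kseq A x : (x \in kseq A) = (x \in kset A).
Proof. by rewrite mem_sort. Qed.

Lemma kseq_surj (s : seq nat) : sorted ltn s -> size s = r ->
  exists A, kseq A = s.
Proof.
rewrite ltn_sorted_uniq_leq => /andP[us ss] sr.
have c : #|` [fset x in s]%fset| == r.
  by rewrite card_fseq undup_id // sr.
exists (exist (fun A : {fset nat} => #|` A| == r) _ c); rewrite /kseq /kset /=.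
apply: (sorted_eq leq_trans anti_leq) => //; first exact: sort_sorted leq_total _.
rewrite perm_sort; apply: uniq_perm => //; first exact: fset_uniq.
by move=> x; rewrite !inE.
Qed.

Lemma kadj_sym A B : kadj A B = kadj B A.
Proof. by rewrite /kadj /= eq_sym orbC. Qed.

Lemma kwalk0 A B : kwalk A B 0 <-> A = B.
Proof.
split=> [[p [_ <- /size0nil ->]]//|->].
by exists [::].
Qed.

Lemma kwalk_cat A B C m n : kwalk A B m -> kwalk B C n -> kwalk A C (m + n).
Proof.
move=> [p [pp lp <-]] [q [pq lq <-]]; exists (p ++ q).
by rewrite cat_path last_cat lp pp pq size_cat.
Qed.

Lemma kwalk_sym A B n : kwalk A B n -> kwalk B A n.
Proof.
move=> [p [pp lp <-]]; exists (rev (belast A p)); split.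
- rewrite -lp rev_path; under eq_path do rewrite kadj_sym; exact: pp.
- case: p pp lp => [//|x p] _ _ /=.
  by rewrite rev_cons last_rcons.
- by rewrite size_rev size_belast.
Qed.

Lemma kwalk_above A B :
  (forall a b, a \in kset A -> b \in kset B -> (a < b)%N) ->
  exists n, kwalk A B n.
Proof.
move=> AB; case: (posnP r) => [r0|r0].
  exists 0%N; apply/kwalk0/val_inj.
  have z C : val C = fset0.
    by apply/eqP; rewrite -cardfs_eq0 (eqP (valP C)) r0.
  by rewrite !z.
pose s := kseq A ++ kseq B.
have ss : sorted ltn s.
  rewrite (sorted_pairwise ltn_trans) pairwise_cat -!(sorted_pairwise ltn_trans).
  rewrite !kseq_sorted !andbT; apply/allrelP => a b.
  by rewrite !mem_kseq; exact: AB.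
have szs : size s = (r + r)%N by rewrite size_cat !size_kseq.
have H k : (k <= r)%N -> exists2 C, kseq C = take r (drop k s) & exists n, kwalk A C n.
  elim: k => [_|k IH kr].
    exists A; last by exists 0%N; exact/kwalk0.
    by rewrite drop0 take_size_cat // size_kseq.
  have [C Ce [n AC]] := IH (ltnW kr).
  have [||D De] := kseq_surj (s := take r (drop k.+1 s)).
  - by apply: take_sorted; apply: drop_sorted.
  - by rewrite size_takel // size_drop szs leq_subRL ?leq_add2r // (leq_trans kr) // leq_addr.
  exists D => //; exists (n + 1)%N; apply: (kwalk_cat AC).
  have kC i : (i < r)%N -> kelt C i = nth 0%N s (k + i).
    by move=> ir; rewrite /kelt -/(kseq C) Ce nth_take // nth_drop.
  have kD i : (i < r)%N -> kelt D i = nth 0%N s (k + i).+1.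
    by move=> ir; rewrite /kelt -/(kseq D) De nth_take // nth_drop addSn.
  have lts i : (i < r)%N -> (nth 0%N s (k + i) < nth 0%N s (k + i).+1)%N.
    move=> ir; apply: (sorted_ltn_nth ltn_trans) => //; rewrite inE szs.
    + by rewrite -addnS leq_add // ltnW.
    + by rewrite -addSn -addnS leq_add.
  exists [:: D]; split=> //=; rewrite andbT; apply/andP; split.
    apply/eqP => CD; have := lts 0%N r0.
    by rewrite -kC // -kD // CD ltnn.
  apply/orP; left; apply/andP; split; apply/forallP => i.
    by rewrite kC // kD // ltnW // lts.
  by apply/implyP => ir; rewrite kC // kD // addnS.
have [C Ce [n AC]] := H r (leqnn r).
exists n; suff <- : C = B by [].
apply/val_inj/fsetP => x; rewrite -[val C]/(kset C) -[val B]/(kset B) -!mem_kseq Ce.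
by rewrite /s drop_size_cat ?size_kseq // take_oversize // size_kseq.
Qed.

Lemma kconnected A B : exists n, kwalk A B n.
Proof.
pose m := (\max_(a <- kset A) a + \max_(b <- kset B) b).+1%N.
have [D De] := kseq_surj (s := iota m r) (iota_ltn_sorted _ _) (size_iota _ _).
have big d : d \in kset D -> (m <= d)%N.
  by rewrite -mem_kseq De mem_iota => /andP[].
have [|n AD] := @kwalk_above A D.
  move=> a d aA /big; apply: leq_trans; rewrite ltnS.
  by apply: leq_trans (leq_addr _ _); exact: (@leq_bigmax_seq _ _ _ id).
have [|p BD] := @kwalk_above B D.
  move=> a d aB /big; apply: leq_trans; rewrite ltnS.
  by apply: leq_trans (leq_addl _ _); exact: (@leq_bigmax_seq _ _ _ id).
exists (n + p)%N; exact: kwalk_cat AD (kwalk_sym BD).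
Qed.

Lemma kwalk_exists A B : exists n, `[< kwalk A B n >].
Proof. by have [n w] := kconnected A B; exists n; apply/asboolP. Qed.

Definition kdist A B : nat := ex_minn (kwalk_exists A B).

Lemma kdistP A B : kwalk A B (kdist A B).
Proof. by rewrite /kdist; case: ex_minnP => n /asboolP. Qed.

Lemma kdist_le A B n : kwalk A B n -> (kdist A B <= n)%N.
Proof. by move=> w; rewrite /kdist; case: ex_minnP => m _; apply; exact/asboolP. Qed.

End Connected.

(* K_r(N) as a metric space; the phantom R only fixes the type in which the
   integer-valued distance is read. *)
Definition kalton (R : realType) (r : nat) : Type := ksubset r.

HB.instance Definition _ (R : realType) (r : nat) := Choice.on (kalton R r).

Section KaltonMetric.
Context (R : realType) (r : nat).
Implicit Types A B C : kalton R r.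

Let dist A B : R := (kdist A B)%:R.

Let distxx A : dist A A = 0.
Proof. by apply/eqP; rewrite pnatr_eq0 -leqn0; apply/kdist_le/kwalk0. Qed.

Let dist_positivity A B : dist A B = 0 -> A = B.
Proof.
by move=> /eqP; rewrite pnatr_eq0 => /eqP d0; apply/kwalk0; rewrite -d0; exact: kdistP.
Qed.

Let dist_sym A B : dist A B = dist B A.
Proof.
congr (_%:R); apply/eqP; rewrite eqn_leq.
by rewrite !kdist_le //; apply/kwalk_sym/kdistP.
Qed.

Let dist_triangle B A C : dist A C <= dist A B + dist B C.
Proof.
rewrite /dist -natrD ler_nat; apply: kdist_le.
exact: kwalk_cat (kdistP _ _) (kdistP _ _).
Qed.

HB.instance Definition _ := isMetric.Build R (kalton R r)
  distxx dist_positivity dist_sym dist_triangle.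

Lemma mdist_kaltonE A B : mdist A B = (kdist A B)%:R.
Proof. by []. Qed.

End KaltonMetric.

Section PropertyQ.
Local Open Scope ereal_scope.
Context {R : realType} (M : metricType R).

Definition property_Q (eps delta : R) : Prop :=
  forall (r : nat) (f : kalton R r -> M), (0 < r)%N ->
    omega_at f 1%R <= delta%:E ->
    exists2 N : set nat, infinite_set N &
      forall A B : kalton R r,
        [set` kset A] `<=` N -> [set` kset B] `<=` N ->
        (forall a b, a \in kset A -> b \in kset B -> (a < b)%N) ->
        (mdist (f A) (f B) <= eps)%R.

(* delta = 0 always belongs to this set, since K_r(N) is connected *)
Definition Delta (eps : R) : \bar R :=
  ereal_sup [set delta%:E | delta in
    [set delta : R | (0 <= delta)%R /\ property_Q eps delta]].

Definition Q_const : \bar R :=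
  ereal_sup [set c%:E | c in
    [set c : R | (0 <= c)%R /\
      forall eps : R, (0 < eps)%R -> (c * eps)%:E <= Delta eps]].

Definition has_property_Q : Prop := 0 < Q_const.

End PropertyQ.

(* Main.v *)
(** Push a badly behaved map [f : K_r(N) -> X] forward through [phi : X -> E].
    Since property Q of a normed space is invariant under scaling, [X] fails
    Q(eps, delta) for all [eps, delta > 0].  So for each [t] there is a [t]-Lipschitz
    [f] that keeps some pair [A < B] at distance more than [eps] in every infinite
    subset of N, while [phi \o f] has modulus at most [omega_phi(t)] and hence is
    [e]-concentrated on some infinite subset as soon as [omega_phi(t) < Q_E * e].
    This gives [kappa_phi(eps) <= e] for every [eps]. *)
Require Import Defs.
From mathcomp Require Import all_boot all_order all_algebra.
From mathcomp Require Import all_classical all_reals all_analysis.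

Import Order.TTheory GRing.Theory Num.Theory.

Local Open Scope classical_set_scope.
Local Open Scope ereal_scope.

Section Moduli.
Context {R : realType} {M1 M2 : metricType R}.
Implicit Types (phi : M1 -> M2) (t d : R).

Lemma omega_at_leP phi t d : omega_at phi t <= d%:E <->
  forall x y, (mdist x y <= t)%R -> (mdist (phi x) (phi y) <= d)%R.
Proof.
split=> [le_d x y xy|le_d].
  by rewrite -lee_fin; apply: le_trans le_d; apply: ereal_sup_ubound; exists (x, y).
by apply: ge_ereal_sup => _ [[x y] /= xy <-]; rewrite lee_fin le_d.
Qed.

Lemma kappa_at_le phi t x y : (t <= mdist x y)%R ->
  kappa_at phi t <= (mdist (phi x) (phi y))%:E.
Proof. by move=> xy; apply: ereal_inf_lbound; exists (x, y). Qed.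

Lemma kappa_ge0 phi : 0 <= kappa phi.
Proof.
apply: (@le_trans _ _ (kappa_at phi 1%R)).
  by apply: le_ereal_inf_tmp => _ [p _ <-]; rewrite lee_fin mdist_ge0.
by apply: ereal_sup_ubound; exists 1%R => //=.
Qed.

(** The point of [M1] matters: over an empty space the suprema in [omega_at] are [-oo]. *)
Lemma omega_ge0 phi : M1 -> 0 <= omega phi.
Proof.
move=> x; apply: le_ereal_inf_tmp => _ [t /= t0 <-].
apply: (@le_trans _ _ (mdist (phi x) (phi x))%:E); first by rewrite mdistxx.
by apply: ereal_sup_ubound; exists (x, x) => //=; rewrite mdistxx ltW.
Qed.

End Moduli.

Lemma Delta_gtP {R : realType} {M : metricType R} (eps : R) (x : \bar R) :
  x < Delta M eps -> exists2 delta : R, x < delta%:E & property_Q M eps delta.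
Proof. by move=> /ereal_sup_gt[_ [delta [_ Qd] <-] xd]; exists delta. Qed.

(** Replacing [f] by [a^-1 *: f] divides every distance between values by [a]. *)
Lemma property_Q_scale {R : realType} {V : normedModType R} {eps delta : R} (a : R) :
  (0 < a)%R -> property_Q (norm_metric V) eps delta ->
  property_Q (norm_metric V) (a * eps)%R (a * delta)%R.
Proof.
move=> a0 Q r f r0 /omega_at_leP f_le.
have distZ x y : (mdist (a^-1 *: (x : V) : norm_metric V) (a^-1 *: (y : V) : norm_metric V)
    = a^-1 * mdist (x : norm_metric V) y)%R.
  by rewrite !mdist_normE -scalerBr normrZ gtr0_norm // invr_gt0.
have [|N infN NP] := Q r (fun A => (a^-1 *: (f A : V))%R : norm_metric V) r0.
  by apply/omega_at_leP => A B AB; rewrite distZ ler_pdivrMl // f_le.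
exists N => // A B AN BN AB.
by have := NP A B AN BN AB; rewrite distZ ler_pdivrMl.
Qed.

Lemma property_Q_has_property_Q {R : realType} {V : normedModType R} (eps delta : R) :
  (0 < eps)%R -> (0 < delta)%R -> property_Q (norm_metric V) eps delta ->
  has_property_Q (norm_metric V).
Proof.
move=> e0 d0 Q.
apply: (@lt_le_trans _ _ (delta / eps)%:E); first by rewrite lte_fin divr_gt0.
apply: ereal_sup_ubound; exists (delta / eps)%R => //; split=> [|e e_gt0].
  by rewrite divr_ge0 // ltW.
apply: ereal_sup_ubound; exists (delta / eps * e)%R => //; split.
  by rewrite !mulr_ge0 ?invr_ge0 // ltW.
(* The dilation by [e / eps] carries [eps] to [e] and keeps the ratio [delta / eps]. *)
have := property_Q_scale (e / eps)%R (divr_gt0 e_gt0 e0) Q.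
by rewrite divfK ?gt_eqF // mulrAC (mulrC e) mulrAC.
Qed.

Section Separation.
Context {R : realType} {M1 M2 : metricType R}.
Context (M1_noQ :
  forall eps delta : R, (0 < eps)%R -> (0 < delta)%R -> ~ property_Q M1 eps delta).
Implicit Types phi : M1 -> M2.

(** If [eps < kappa_at phi s], points at distance at least [s] have images more than [eps] apart.
    Concentration of [phi \o f] within [eps] then forces that of [f] within [s], so [M1] would have
    Q(s, t). *)
Lemma kappa_at_le_property_Q phi (s t eps delta : R) : (0 < s)%R -> (0 < t)%R ->
  omega_at phi t <= delta%:E -> property_Q M2 eps delta ->
  kappa_at phi s <= eps%:E.
Proof.
move=> s0 t0 /omega_at_leP phi_le Q; rewrite leNgt; apply/negP => eps_lt.
apply: (M1_noQ s t s0 t0) => r f r0 /omega_at_leP f_le.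
have [|N infN NP] := Q r (phi \o f) r0.
  by apply/omega_at_leP => A B AB; apply/phi_le/f_le.
exists N => // A B AN BN AB; rewrite leNgt; apply/negP => far.
have := lt_le_trans eps_lt (kappa_at_le phi _ _ _ (ltW far)).
by rewrite lte_fin ltNge (NP A B AN BN AB).
Qed.

(** The strict inequality leaves room for [t] and [delta] with [omega_at phi t < delta] and Q(eps,
    delta), even if neither extremum is attained. *)
Lemma kappa_le_property_Q phi (eps : R) :
  omega phi < Delta M2 eps -> kappa phi <= eps%:E.
Proof.
move=> /ereal_inf_lt[_ [t /= t0 <-]] /Delta_gtP[delta /ltW phi_le Q].
by apply: ge_ereal_sup => _ [s /= s0 <-]; apply: kappa_at_le_property_Q phi_le Q.
Qed.

Lemma kappa_le_omega_div phi (c w : R) : (0 < c)%R ->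
  (forall eps : R, (0 < eps)%R -> (c * eps)%:E <= Delta M2 eps) ->
  (0 <= w)%R -> omega phi = w%:E -> kappa phi <= (w / c)%:E.
Proof.
move=> c0 cP w0 phiE; apply/lee_addgt0Pr => e e0.
(* Take [eps = w / c + e], for which [c * eps = w + c * e] exceeds [w]. *)
rewrite -EFinD; apply: kappa_le_property_Q; rewrite phiE.
have wce0 : (0 < w / c + e)%R by rewrite ltr_wpDl // divr_ge0 // ltW.
apply: lt_le_trans (cP _ wce0).
by rewrite lte_fin mulrDr mulrCA divff ?gt_eqF // mulr1 ltrDl mulr_gt0.
Qed.

Lemma separation_ratio_le phi : M1 -> has_property_Q M2 ->
  separation_ratio phi <= 1 / Q_const M2.
Proof.
move=> x Q_gt0; rewrite /separation_ratio mul1e.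
have Qinv_ge0 : 0 <= (Q_const M2)^-1 by rewrite inve_ge0 ltW.
have : 0 <= omega phi by exact: omega_ge0.
case w_def : (omega phi) => [w| |] //; last by rewrite invey mule0.
rewrite lee_fin => w0.
(* One positive admissible constant makes [kappa phi] finite, and zero when [w = 0]. *)
have [_ [c0 [_ c0P] <-]] := ereal_sup_gt Q_gt0; rewrite lte_fin => c0_gt0.
have := kappa_le_omega_div phi _ _ c0_gt0 c0P w0 w_def.
have := kappa_ge0 phi.
case k_def : (kappa phi) => [k| |] //; rewrite !lee_fin le_eqVlt.
case/predU1P=> [<- _|k0 k_le]; first by rewrite mul0e.
have w_gt0 : (0 < w)%R by have := lt_le_trans k0 k_le; rewrite pmulr_lgt0 ?invr_gt0.
(* For every admissible [c > 0], [k <= w / c] gives [c <= w / k]; the supremum over [c] is then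
   inverted. *)
have Q_le : Q_const M2 <= (w / k)%:E.
  apply: ge_ereal_sup => _ [c [c_ge0 cP] <-]; rewrite lee_fin.
  move: c_ge0; rewrite le_eqVlt => /predU1P[<-|c_gt0]; first by rewrite divr_ge0 // ltW.
  have := kappa_le_omega_div phi _ _ c_gt0 cP w0 w_def.
  by rewrite k_def lee_fin ler_pdivlMr // mulrC -ler_pdivlMr.
rewrite inver gt_eqF // -EFinM -[(k / w)%R]invrK invf_div.
rewrite (_ : _%:E = (w / k)%:E^-1); last by rewrite inver gt_eqF // divr_gt0.
by rewrite inve_ple ?inveK // !inE ?inve_ge0 ?lee_fin ?ltW // ?divr_gt0.
Qed.

End Separation.

Theorem proposition3p7 (R : realType) (X E : completeNormedModType R)
    (hX : ~ has_property_Q (norm_metric X))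
    (hE : has_property_Q (norm_metric E)) :
  coarse_ratio (norm_metric X) (norm_metric E) <= 1 / Q_const (norm_metric E).
Proof.
apply: ge_ereal_sup => _ [phi _ <-].
apply: separation_ratio_le hE; last exact: (0%R : X).
by move=> eps delta e0 d0 /property_Q_has_property_Q Q; apply/hX/Q.
Qed.
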